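(* Let $K_1,K_2,K_3>0$ and let $r_3,r_4,r_5,r_6>0$ satisfy $r_3/r_4>1$ and $r_5/r_6<1$. Consider the estimators, for $i=1,\dots,n$, $$\dot{\hat x}_{i1}(t)=-K_1\,e_i(t)^{[r_3/r_4]}-K_2\,e_i(t)^{[r_5/r_6]}-K_3\,\mathrm{sgn}(e_i(t)),\qquad e_i(t)=\sum_{j=0}^{n}a_{ij}\big(\bar x_{i1}(t)-\bar x_{j1}(t)\big),$$ where $\bar x_{i1}=\hat x_{i1}-x_o$ for $i=1,\dots,n$, $\bar x_{01}=0$ and $a_{i0}=b_i$. Let $H:=L+B$, where $L$ is the Laplacian matrix of $G$ and $B$ is the leader adjacency matrix, and suppose $H$ is positive definite. If the velocity of the leader is bounded as $$K_3\ge\sup_{t\ge0}\|\dot x_o(t)\|_\infty,$$ then there exists a globally bounded settling time $T_e>0$ such that $\hat x_{i1}(t)\equiv x_o(t)$ (for every $i$) for any initial condition $(\hat x_{i1}(0),x_o(0))\in\mathbb R^3\times\mathbb R^3$ and for all $t\ge T_e$.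
   Context: For $x,p\in\mathbb R$, $x^{[p]}:=|x|^p\,\mathrm{sgn}(x)$, applied componentwise to vectors, as is $\mathrm{sgn}$ (values $-1,0,1$). Solutions of differential equations with discontinuous right-hand side are in Filippov's sense. $n\ge2$ agents communicate over an undirected weighted graph $G$ with node set $V=\{1,\dots,n\}$ and symmetric adjacency matrix $A=[a_{ij}]$, $a_{ij}\ge0$; $L=D-A$ with $D=\mathrm{diag}\{d_{11},\dots,d_{nn}\}$, $d_{ii}=\sum_{j=1}^na_{ij}$. A virtual leader has position $x_o(t)\in\mathbb R^3$, a twice differentiable function of time. $B=\mathrm{diag}\{b_1,\dots,b_n\}$ with $b_i>0$ if the leader's information is available to agent $i$ and $b_i=0$ otherwise; at each time instant there is at least one $i$ with $b_i=1$. $\hat x_{i1}(t)\in\mathbb R^3$ is agent $i$'s estimate of the leader position. ''Globally bounded settling time'' means the settling time is bounded by a constant independent of the initial conditions. *)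

(* Defs.v *)
From HB Require Import structures.
From mathcomp Require Import all_boot all_order all_algebra.
From mathcomp Require Import all_classical all_reals all_analysis.

Set Implicit Arguments.
Unset Strict Implicit.
Unset Printing Implicit Defensive.

Import Order.TTheory GRing.Theory Num.Theory.
Import numFieldNormedType.Exports.

Local Open Scope classical_set_scope.
Local Open Scope ring_scope.

Section Filippov.
Context {R : realType}.

(* The time axis is [0, +oo[, so the derivative at 0 is one-sided. *)
Definition derivative_on_nneg (V : normedModType R) (f f' : R -> V) : Prop :=
  forall t, 0 <= t ->
    (s - t)^-1 *: (f s - f t) @[s --> within [set s | 0 <= s] t^'] --> f' t.

Definition abs_continuous (V : normedModType R) (a b : R) (f : R -> V) : Prop :=
  forall e : R, 0 < e -> exists2 d : R, 0 < d &
    forall (N : nat) (u v : 'I_N -> R),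
      (forall i, [/\ a <= u i, u i <= v i & v i <= b]) ->
      trivIset [set: 'I_N] (fun i => `]u i, v i[%classic) ->
      \sum_i (v i - u i) < d ->
      \sum_i `|f (v i) - f (u i)| < e.

(* Lebesgue-null subsets of R^(m * p): countable covers by closed boxes of
   arbitrarily small total volume. *)
Definition lebesgue_null m p (N : set 'M[R]_(m, p)) : Prop :=
  forall e : R, 0 < e -> exists lo hi : nat -> 'M[R]_(m, p),
    [/\ forall l i k, lo l i k <= hi l i k,
        N `<=` \bigcup_l [set x : 'M[R]_(m, p) | forall i k,
                                  lo l i k <= x i k <= hi l i k]
      & (\sum_(0 <= l <oo)
          (\prod_(i < m) \prod_(k < p) (hi l i k - lo l i k))%:E <= e%:E)%E].

Definition closed_convex_hull (V : normedModType R) (S : set V) : set V :=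
  smallest [set C | closed C /\ convex_set C] S.

Definition filippov_map m p (g : 'M[R]_(m, p) -> 'M[R]_(m, p))
    (x : 'M[R]_(m, p)) : set 'M[R]_(m, p) :=
  \bigcap_(d in [set d : R | 0 < d]) \bigcap_(N in @lebesgue_null m p)
    closed_convex_hull (g @` (ball x d `\` N)).

(* Filippov solutions on [0, +oo[ of x' = f t x. *)
Definition filippov_solution m p (f : R -> 'M[R]_(m, p) -> 'M[R]_(m, p))
    (x : R -> 'M[R]_(m, p)) : Prop :=
  (forall T, 0 < T -> abs_continuous 0 T x) /\
  {ae lebesgue_measure, forall t : R, 0 < t ->
     derivable x t 1 /\ filippov_map (f t) (x t) ('D_1 x t)}.

End Filippov.

Section Estimator.
Context {R : realType}.

Definition sigpow (x p : R) : R := `|x| `^ p * Num.sg x.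

Definition laplacian n (A : 'M[R]_n) : 'M[R]_n :=
  diag_mx (\row_i \sum_j A i j) - A.

Definition posdefmx n (M : 'M[R]_n) : Prop :=
  M^T = M /\ forall v : 'cV[R]_n, v != 0 -> 0 < (v^T *m M *m v) 0 0.

(* Row [i] of [x] is the estimate of agent [i] and [xo] is the current leader
   position. The [b]-term is the summand of the leader (node 0): its weight is
   [b 0 i] and its error is 0. *)
Definition estimation_error n (A : 'M[R]_n) (b : 'rV[R]_n) (xo : 'rV[R]_3)
    (x : 'M[R]_(n, 3)) : 'M[R]_(n, 3) :=
  let xbar i := row i x - xo in
  \matrix_(i < n) (b 0 i *: (xbar i - 0)
                   + \sum_(j < n) A i j *: (xbar i - xbar j)).

Definition estimator n (A : 'M[R]_n) (b : 'rV[R]_n) (K1 K2 K3 p q : R)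
    (xo : R -> 'rV[R]_3) (t : R) (x : 'M[R]_(n, 3)) : 'M[R]_(n, 3) :=
  let e := estimation_error A b (xo t) x in
  \matrix_(i < n, k < 3)
    (- K1 * sigpow (e i k) p - K2 * sigpow (e i k) q - K3 * Num.sg (e i k)).

End Estimator.

(* Main.v *)
Require Import Defs.
From HB Require Import structures.
From mathcomp Require Import all_boot all_order all_algebra.
From mathcomp Require Import all_classical all_reals all_analysis.
From mathcomp Require Import ring lra.

Set Implicit Arguments.
Unset Strict Implicit.
Unset Printing Implicit Defensive.

Import Order.TTheory GRing.Theory Num.Theory.
Import numFieldNormedType.Exports.

Local Open Scope classical_set_scope.
Local Open Scope ring_scope.

(** With [y_i] the error of agent [i], the estimation errors are [e = H y].
    Along a Filippov solution [W = sum_k y_k^T H y_k] satisfies, for almost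
    every time, [W' = 2 sum_ik e_ik (x_ik' - vo_k)].  Entries with [e_ik = 0]
    do not contribute, and where [e_ik <> 0] the right-hand side is continuous,
    so its set-valued regularization is single-valued there; the sign term
    absorbs [vo].  Since [W <= C |e|^2], this gives
    [W' <= - al W^((p+1)/2) - be W^((q+1)/2)] with [(q+1)/2 < 1 < (p+1)/2]:
    the first term brings [W] below [1] in time [1 / (al ((p+1)/2 - 1))]
    whatever its initial value, and the second one then brings it to [0] in
    time [1 / (be (1 - (q+1)/2))].  The differential inequality holds only
    almost everywhere, so it is integrated by absolute continuity. *)

(** * Monotonicity from an almost-everywhere derivative bound *)

(** At the supremum of the points where [P] holds, the step jumps from some [u] on its left straight
    to a [v] on its right, so [P] is never passed to a limit. *)
Lemma continuous_induction (R : realType) (P : R -> Prop) (a b : R) :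
  a <= b -> P a ->
  (forall t, a <= t <= b -> exists2 d : R, 0 < d &
     forall u v, a <= u -> t - d < u -> u <= t -> t <= v -> v < t + d ->
       v <= b -> P u -> P v) ->
  P b.
Proof.
move=> ab Pa step.
pose E := [set t | a <= t <= b /\ P t].
have Ea : E a by split=> //; rewrite lexx.
have supE : has_sup E.
  by split; [exists a | exists b => t [/andP[_ ->]]].
have lesup t : E t -> t <= sup E by move=> Et; apply: (ub_le_sup supE.2).
have asup : a <= sup E by exact: lesup.
have supb : sup E <= b by apply: ge_sup => [|t [/andP[]]//]; exists a.
have [|d d0 stepE] := step (sup E); first by rewrite asup.
have [u [/andP[au ub] Pu] du] := sup_adherent d0 supE.
have us : u <= sup E by apply: lesup; split=> //; rewrite au ub.
have [db|bd] := leP (sup E + d / 2) b.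
  have : E (sup E + d / 2).
    split; first by rewrite db andbT (le_trans asup)// lerDl; lra.
    by apply: (stepE u) => //; lra.
  by move/lesup => ?; exfalso; lra.
by apply: (stepE u) => //; lra.
Qed.

(** An interval that straddles [t] splits there into two pieces, each of slope at most [c]; this is
    why differentiability at the single point [t] is enough. *)
Lemma derivable_slope_lt (R : realType) (f : R -> R) (t c : R) :
  derivable f t 1 -> 'D_1 f t < c ->
  exists2 d : R, 0 < d & forall u v, t - d < u -> u <= t -> t <= v ->
    v < t + d -> f v - f u <= c * (v - u).
Proof.
move=> df Dc.
have : \forall h \near 0^', h^-1 *: (f (h *: 1 + t) - f t) < c.
  by apply: (cvgr_lt ('D_1 f t)) => //; exact: df.
rewrite near_withinE => /nbhs_ballP[d /= d0 dP].
have slope h : `|h| < d -> h != 0 -> h^-1 * (f (h + t) - f t) < c.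
  move=> hd h0; have := dP h; rewrite /ball/= sub0r normrN => /(_ hd h0).
  by rewrite [h *: 1]mulr1.
exists d => // u v du ut tv vd.
have fv : f v - f t <= c * (v - t).
  have [->|tv'] := eqVneq v t; first by rewrite !subrr mulr0.
  have vt0 : 0 < v - t by rewrite subr_gt0 lt_neqAle eq_sym tv'.
  have := slope (v - t); rewrite gtr0_norm// gt_eqF// subrK => /(_ _ isT).
  by rewrite mulrC ltr_pdivrMr// => H; apply/ltW/H; lra.
have fu : f t - f u <= c * (t - u).
  have [->|ut'] := eqVneq u t; first by rewrite !subrr mulr0.
  have tu0 : 0 < t - u by rewrite subr_gt0 lt_neqAle ut'.
  have := slope (u - t); rewrite distrC gtr0_norm// subr_eq0 ut' subrK => /(_ _ isT).
  rewrite -(opprB t u) invrN mulNr -mulrN opprB mulrC ltr_pdivrMr// => H.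
  by apply/ltW/H; lra.
have -> : f v - f u = (f v - f t) + (f t - f u) by ring.
have -> : c * (v - u) = c * (v - t) + c * (t - u) by ring.
exact: lerD.
Qed.

Lemma negligible_open_cover (R : realType) (N : set R) (e : R) :
  lebesgue_measure.-negligible N -> 0 < e ->
  exists U : set R, [/\ open U, N `<=` U & (lebesgue_measure U < e%:E)%E].
Proof.
move=> [M [mM M0 NM]] e0.
have [|U [oU MU mU]] := lebesgue_regularity_outer mM _ e0.
  by rewrite [X in (X < _)%E]M0 ltry.
exists U; split => //; first exact: subset_trans MU.
rewrite -[U](setDUK MU) setUC measureU0//.
by apply: measurableD => //; exact: measurable_realfun.open_measurable.
Qed.

(* The set where the derivative bound fails is covered by an open set [U] of
   small measure; inside [U] the increments of [f] are collected in the finite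
   family [(u, v)] and absolute continuity makes their sum small. *)
Lemma abs_continuous_nonincreasing (R : realType) (a b : R) (f : R -> R) :
  a <= b -> abs_continuous a b f ->
  {ae lebesgue_measure, forall t : R, a < t < b ->
     derivable f t 1 /\ 'D_1 f t <= 0} ->
  f b <= f a.
Proof.
move=> ab fAC [N [mN N0 badN]].
suff H eta : 0 < eta -> f b - f a <= eta + eta * (b - a).
  rewrite -subr_le0; apply/ler_addgt0Pr => eps eps0; rewrite add0r.
  have ba1 : 0 < 1 + (b - a) by lra.
  have := H (eps / (1 + (b - a))) (divr_gt0 eps0 ba1).
  set y := eps / _; have -> : eps = y * (1 + (b - a)) by rewrite divfK// gt_eqF.
  by lra.
move=> eta0; have [d d0 fd] := fAC _ eta0.
(* The endpoints join the null set because the derivative bound is known only strictly between [a]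
   and [b]. *)
have nN : lebesgue_measure.-negligible (N `|` [set a; b]).
  exists (N `|` [set a; b]); split => //.
    by apply: measurableU => //; exact: measurableU.
  have m1 x : lebesgue_measure [set x : R] = 0%E by exact: lebesgue_measure_set1.
  rewrite measureU0//; first exact: measurableU.
  by rewrite measureU0//; exact: m1.
have [U [oU NU mU]] := negligible_open_cover nN d0.
pose P t := exists (n : nat) (u v : nat -> R),
  [/\ forall i, (i < n)%N -> [/\ a <= u i, u i <= v i, v i <= t &
        `]u i, v i[%classic `<=` U],
      forall i j, (i < j)%N -> (j < n)%N -> v i <= u j &
      f t - f a <= \sum_(i < n) (f (v i) - f (u i)) + eta * (t - a)].
suff [n [u [v [uv dis fab]]]] : P b.
  have tI : trivIset [set: 'I_n] (fun i => `]u i, v i[%classic).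
    apply/trivIsetP => i j _ _ ij; apply/seteqP; split => // x /=.
    rewrite !in_itv/= => -[/andP[ix xi] /andP[jx xj]].
    have [lij|lji|/val_inj eij] := ltngtP i j; last by rewrite eij eqxx in ij.
    - by have := dis _ _ lij (ltn_ord j); lra.
    - by have := dis _ _ lji (ltn_ord i); lra.
  (* The intervals are disjoint and lie in [U], so their total length is at most the measure of
     [U]. *)
  have sumd : \sum_(i < n) (v i - u i) < d.
    rewrite -lte_fin (le_lt_trans _ mU)// -sumEFin.
    rewrite [leLHS](eq_bigr (fun i : 'I_n => lebesgue_measure `]u i, v i[%classic)).
      rewrite -measure_bigsetU_ord//; apply: le_measure.
      - by rewrite inE; exact: bigsetU_measurable.
      - by rewrite inE; exact: measurable_realfun.open_measurable.
      - rewrite -(bigcup_mkord n (fun i => `]u i, v i[%classic)).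
        by move=> x [i /= /uv[_ _ _ uU]]; exact: uU.
    move=> i _; rewrite lebesgue_measure_itv/= lte_fin.
    have [_ uvi _ _] := uv i (ltn_ord i).
    case: ltP => // vui; have -> : v i = u i by apply/le_anti; rewrite vui uvi.
    by rewrite subrr.
  have {}/fd : forall i : 'I_n, [/\ a <= u i, u i <= v i & v i <= b].
    by move=> i; have [] := uv i (ltn_ord i).
  move=> /(_ tI sumd) lt_eta; apply: (le_trans fab); rewrite lerD2r.
  apply: le_trans (ltW lt_eta); apply: ler_sum => i _; exact: ler_norm.
apply: (continuous_induction ab).
  exists 0%N, (fun=> a), (fun=> a); split => //.
  by rewrite big_ord0 !subrr mulr0 addr0.
move=> t /andP[at_ tb].
(* Inside [U] the whole step from [x] to [y] becomes a new last interval; outside, the slope bound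
   [eta] at [t] pays for the step and the family stays the same. *)
have [Ut|nUt] := pselect (U t).
  have /nbhs_ballP[e /= e0 eU] : nbhs t U by exact: open_nbhs_nbhs.
  exists e => // x y ax tx xt ty yt yb [n [u [v [uv dis fab]]]].
  exists n.+1, (fun i => if (i < n)%N then u i else x),
    (fun i => if (i < n)%N then v i else y); split.
  - move=> i; rewrite ltnS leq_eqVlt => /orP[/eqP->|ilt].
      rewrite ltnn; split => //; first exact: le_trans ty.
      move=> z /=; rewrite in_itv/= => /andP[xz zy]; apply: eU.
      by rewrite /ball/= ltr_distlC; lra.
    rewrite ilt; have [? ? vix ?] := uv i ilt; split => //.
    by rewrite (le_trans vix)// (le_trans xt).
  - move=> i j ij; rewrite ltnS leq_eqVlt => /orP[/eqP jn|jlt].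
      by subst j; rewrite ij ltnn; have [] := uv i ij.
    by rewrite jlt (ltn_trans ij jlt); exact: dis.
  - rewrite big_ord_recr/= ltnn.
    under eq_bigr do rewrite ltn_ord.
    have : eta * (x - a) <= eta * (y - a) by rewrite ler_pM2l//; lra.
    by lra.
have tab : a < t < b.
  rewrite !lt_neqAle at_ tb !andbT.
  by apply/andP; split; apply/eqP => tE; apply/nUt/NU; right; [left|right].
have [df Df] : derivable f t 1 /\ 'D_1 f t <= 0.
  by apply: contrapT => ndf; apply/nUt/NU; left; apply: badN => /(_ tab)/ndf.
have [|e e0 fe] := derivable_slope_lt df (_ : 'D_1 f t < eta).
  exact: le_lt_trans eta0.
exists e => // x y ax tx xt ty yt yb [n [u [v [uv dis fab]]]].
exists n, u, v; split => //.
- move=> i /uv[? ? vix ?]; split => //.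
  by rewrite (le_trans vix)// (le_trans xt).
- by have := fe _ _ tx xt ty yt; lra.
Qed.

(** * Absolutely continuous functions *)

(** This single comparison of increments yields the closure properties below: Lipschitz functions,
    sums, products, entries and powers. *)
Lemma abs_continuous_dominated (R : realType) (V W X : normedModType R)
    (a b C : R) (f : R -> V) (g : R -> W) (h : R -> X) :
  abs_continuous a b f -> abs_continuous a b g ->
  (forall u v, a <= u -> u <= v -> v <= b ->
     `|h v - h u| <= C * (`|f v - f u| + `|g v - g u|)) ->
  abs_continuous a b h.
Proof.
move=> fAC gAC hfg e e0.
have D0 : 0 < 1 + `|C| by rewrite ltr_pwDl.
pose e' := e / (1 + `|C|) / 2.
have e'0 : 0 < e' by rewrite !divr_gt0.
have [d1 d10 fd] := fAC _ e'0; have [d2 d20 gd] := gAC _ e'0.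
exists (Num.min d1 d2) => [|n u v uv dis]; first by rewrite lt_min d10.
rewrite lt_min => /andP[/(fd _ _ _ uv dis) fe /(gd _ _ _ uv dis) ge].
have -> : e = (1 + `|C|) * (e' + e').
  by rewrite /e' -splitr mulrC divfK// gt_eqF.
apply: le_lt_trans (_ : (1 + `|C|) * (\sum_i `|f (v i) - f (u i)| +
    \sum_i `|g (v i) - g (u i)|) < _).
  rewrite -big_split mulr_sumr; apply: ler_sum => i _ /=.
  have [au uvi vb] := uv i.
  rewrite (le_trans (hfg _ _ au uvi vb))// ler_wpM2r ?addr_ge0//.
  by rewrite (le_trans (ler_norm C))// lerDr.
by rewrite ltr_pM2l// ltrD.
Qed.

Lemma abs_continuous_id (R : realType) (a b : R) : abs_continuous a b (@id R).
Proof.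
move=> e e0; exists e => // n u v uv _; apply: le_lt_trans.
by apply: ler_sum => i _; have [_ uvi _] := uv i; rewrite ger0_norm// subr_ge0.
Qed.

Lemma abs_continuous_lipschitz (R : realType) (V : normedModType R) (a b C : R)
    (f : R -> V) :
  (forall u v, a <= u -> u <= v -> v <= b -> `|f v - f u| <= C * (v - u)) ->
  abs_continuous a b f.
Proof.
move=> fC.
apply: (@abs_continuous_dominated _ _ _ _ a b (C / 2) id id);
  [exact: abs_continuous_id..|].
move=> u v au uv vb; rewrite (le_trans (fC _ _ au uv vb))//.
by rewrite ger0_norm ?subr_ge0//; lra.
Qed.

Lemma abs_continuousD (R : realType) (V : normedModType R) (a b : R)
    (f g : R -> V) :
  abs_continuous a b f -> abs_continuous a b g ->
  abs_continuous a b (fun t => f t + g t).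
Proof.
move=> fAC gAC; apply: (abs_continuous_dominated (C := 1) fAC gAC).
by move=> u v _ _ _; rewrite mul1r opprD addrACA ler_normD.
Qed.

Lemma abs_continuousB (R : realType) (V : normedModType R) (a b : R)
    (f g : R -> V) :
  abs_continuous a b f -> abs_continuous a b g ->
  abs_continuous a b (fun t => f t - g t).
Proof.
move=> fAC gAC; apply: (abs_continuous_dominated (C := 1) fAC gAC).
by move=> u v _ _ _; rewrite mul1r opprD addrACA -opprD ler_normB.
Qed.

Lemma abs_continuous_sum (R : realType) (V : normedModType R) (a b : R)
    (I : Type) (r : seq I) (f : I -> R -> V) :
  (forall i, abs_continuous a b (f i)) ->
  abs_continuous a b (fun t => \sum_(i <- r) f i t).
Proof.
move=> fAC; elim: r => [|i r IHr].
  apply: (@abs_continuous_lipschitz _ _ _ _ 0) => u v _ _ _.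
  by rewrite !big_nil subrr normr0 mul0r.
rewrite (_ : (fun t => _) = (fun t => f i t + \sum_(j <- r) f j t)).
  exact: abs_continuousD.
by apply/funext => t; rewrite big_cons.
Qed.

(** With tolerance 1, [f] moves by less than 1 over any step shorter than [d], so a bound is carried
    along the interval and grows by 1 at each step. *)
Lemma abs_continuous_bounded (R : realType) (V : normedModType R) (a b : R)
    (f : R -> V) :
  abs_continuous a b f ->
  exists M : R, forall t, a <= t -> t <= b -> `|f t| <= M.
Proof.
move=> fAC; have [ab|ba] := leP a b; last first.
  by exists 0 => t at_ tb; have := le_trans at_ tb; rewrite leNgt ba.
have [d d0 fd] := fAC _ ltr01.
pose P t := exists M : R, forall s, a <= s -> s <= t -> `|f s| <= M.
apply: (@continuous_induction _ P a b) => //.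
  by exists `|f a| => s as_ sa; rewrite (@le_anti _ _ a s)// as_ sa.
(* Half of [d], because only the distances of [u] and [v] to the point [t] between them are
   controlled. *)
move=> t _; exists (d / 2) => [|u v au ut _ _ vt vb [M fM]]; first exact: divr_gt0.
exists (M + 1) => s as_ sv; have [su|us] := leP s u.
  by rewrite (le_trans (fM s as_ su))// lerDl.
have {fd} : \sum_(i < 1) `|f s - f u| < 1.
  apply: (fd 1%N (fun=> u) (fun=> s)) => [_||].
  - by split; [|exact: ltW|exact: le_trans vb].
  - by apply/trivIsetP => i j _ _; rewrite !ord1 eqxx.
  - by rewrite big_ord_recr big_ord0/=; lra.
rewrite big_ord_recr big_ord0/= add0r => fsu.
rewrite -(subrK (f u) (f s)) addrC (le_trans (ler_normD _ _))//.
by rewrite lerD ?fM// ltW.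
Qed.

Lemma abs_continuousM (R : realType) (a b : R) (f g : R -> R) :
  abs_continuous a b f -> abs_continuous a b g ->
  abs_continuous a b (fun t => f t * g t).
Proof.
move=> fAC gAC.
have [M fM] := abs_continuous_bounded fAC.
have [N gN] := abs_continuous_bounded gAC.
apply: (abs_continuous_dominated (C := `|M| + `|N|) fAC gAC) => u v au uv vb.
have -> : f v * g v - f u * g u = f v * (g v - g u) + (f v - f u) * g u by ring.
rewrite (le_trans (ler_normD _ _))// !normrM mulrDr addrC lerD//.
  rewrite mulrC ler_wpM2r// (le_trans (gN _ au (le_trans uv vb)))//.
  by rewrite (le_trans (ler_norm N))// lerDr.
rewrite ler_wpM2r// (le_trans (fM _ (le_trans au uv) vb))//.
by rewrite (le_trans (ler_norm M))// lerDl.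
Qed.

Lemma ler_mx_entry_norm (R : realDomainType) (m p : nat) (x : 'M[R]_(m, p)) i k :
  `|x i k| <= `|x|.
Proof.
rewrite [leRHS]mx_normrE.
exact: (le_bigmax _ (fun ik : 'I_m * 'I_p => `|x ik.1 ik.2|) (i, k)).
Qed.

Lemma abs_continuous_entry (R : realType) (m p : nat) (a b : R)
    (x : R -> 'M[R]_(m, p)) i k :
  abs_continuous a b x -> abs_continuous a b (fun t => x t i k).
Proof.
move=> xAC; apply: (abs_continuous_dominated (C := 1) xAC xAC) => u v _ _ _.
have -> : x v i k - x u i k = (x v - x u) i k by rewrite !mxE.
by rewrite mul1r (le_trans (ler_mx_entry_norm _ _ _))// lerDl.
Qed.

(** Away from zero the power function is Lipschitz on the bounded range of [f], even for a negative
    exponent. *)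
Lemma abs_continuous_powR (R : realType) (a b c r : R) (f : R -> R) :
  0 < c -> (forall t, a <= t -> t <= b -> c <= f t) ->
  abs_continuous a b f -> abs_continuous a b (fun t => f t `^ r).
Proof.
move=> c0 cf fAC; have [M fM] := abs_continuous_bounded fAC.
(* The power function is steepest at [M] or at [c], according to the sign of [r - 1]; adding both
   values covers the two cases. *)
pose K := `|r| * (c `^ (r - 1) + M `^ (r - 1)).
have powR_lip x y : c <= x -> x <= y -> y <= M ->
    `|y `^ r - x `^ r| <= K * (y - x).
  move=> cx xy yM.
  have [||z] := @MVT_segment _ (@powR R ^~ r) (fun z => r * z `^ (r - 1)) x y xy.
  - move=> z; rewrite in_itv/= => /andP[xz _]; apply: is_derive1_powR.
    by rewrite (lt_trans _ xz)// (lt_le_trans c0).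
  - apply: derivable_within_continuous => z; rewrite in_itv/= => /andP[xz _].
    by apply: derivable_powR; rewrite in_itv/= andbT (lt_le_trans c0)// (le_trans cx).
  rewrite in_itv/= => /andP[xz zy] ->.
  rewrite normrM (@ger0_norm _ (y - x)) ?subr_ge0// ler_wpM2r ?subr_ge0//.
  rewrite normrM ler_wpM2l// ger0_norm ?powR_ge0//.
  have z0 : 0 < z by rewrite (lt_le_trans c0)// (le_trans cx).
  have [r1|r1] := leP 0 (r - 1).
    rewrite (@le_trans _ _ (M `^ (r - 1))) ?lerDr ?powR_ge0//.
    by apply: ge0_ler_powR; rewrite ?nnegrE//; lra.
  rewrite (@le_trans _ _ (c `^ (r - 1))) ?lerDl ?powR_ge0//.
  rewrite -(opprB 1 r) !powRN lef_pV2 ?posrE ?powR_gt0//; last first.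
    by apply: ge0_ler_powR; rewrite ?nnegrE//; lra.
apply: (abs_continuous_dominated (C := K) fAC fAC) => u v au uv vb.
have fle t : a <= t -> t <= b -> f t <= M.
  by move=> at_ tb; rewrite (le_trans (ler_norm _))// fM.
have K0 : 0 <= K by rewrite mulr_ge0// addr_ge0// powR_ge0.
have ub := le_trans uv vb; have av := le_trans au uv.
suff : `|f v `^ r - f u `^ r| <= K * `|f v - f u|.
  by move/le_trans; apply; rewrite ler_wpM2l// lerDl.
have [fuv|/ltW fvu] := leP (f u) (f v).
  by rewrite (@ger0_norm _ (f v - _)) ?subr_ge0// powR_lip// ?cf ?fle.
by rewrite distrC (distrC (f v)) (@ger0_norm _ (f u - _)) ?subr_ge0//
  powR_lip// ?cf ?fle.
Qed.

(* The derivative may be one-sided at the left endpoint [0], which is why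
   the mean value theorem is replaced by an induction along the interval. *)
Lemma derivative_on_nneg_lipschitz (R : realType) (V : normedModType R) (K : R)
    (f f' : R -> V) :
  derivative_on_nneg f f' -> (forall t, 0 <= t -> `|f' t| <= K) ->
  forall u v, 0 <= u -> u <= v -> `|f v - f u| <= K * (v - u).
Proof.
move=> df f'K u v u0 uv.
(* The slack [eta] makes the bound on the derivative strict, so that it passes to difference
   quotients near each point. *)
suff H eta : 0 < eta -> `|f v - f u| <= (K + eta) * (v - u).
  apply/ler_addgt0Pr => eps eps0.
  have vu1 : 0 < 1 + (v - u) by lra.
  have := H (eps / (1 + (v - u))) (divr_gt0 eps0 vu1).
  move/le_trans; apply; rewrite mulrDl lerD2l mulrAC ler_pdivrMr// ler_pM2l//.
  by lra.
move=> eta0.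
apply: (@continuous_induction _ (fun t => `|f t - f u| <= (K + eta) * (t - u)) u v) => //.
  by rewrite !subrr normr0 mulr0.
move=> t /andP[ut tv]; have t0 := le_trans u0 ut.
have : \forall s \near within [set s | 0 <= s] t^',
    `|(s - t)^-1 *: (f s - f t)| < K + eta.
  apply: (cvgr_lt `|f' t|); last by rewrite (le_lt_trans (f'K t t0))// ltrDl.
  by apply: cvg_norm; exact: df.
rewrite !near_withinE => /nbhs_ballP[d /= d0 dP].
have lip s : 0 <= s -> `|s - t| < d -> `|f s - f t| <= (K + eta) * `|s - t|.
  move=> s0 sd; have [->|st] := eqVneq s t; first by rewrite !subrr !normr0 mulr0.
  have := dP s; rewrite /ball/= distrC => /(_ sd st s0) /ltW.
  rewrite normrZ normfV mulrC ler_pdivrMr//.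
  by rewrite normr_gt0 subr_eq0.
exists d => // x y ux tx xt ty yt yv Px.
have -> : f y - f u = (f y - f t) + (f t - f x) + (f x - f u).
  by rewrite !subrKA.
have -> : y - u = (y - t) + (t - x) + (x - u) by ring.
rewrite (le_trans (ler_normD _ _))// mulrDr lerD// (le_trans (ler_normD _ _))//.
rewrite mulrDr lerD//.
  have := lip y; rewrite (@ger0_norm _ (y - t)) ?subr_ge0//; apply; last by lra.
  exact: le_trans ty.
have := lip x; rewrite (distrC x) (distrC (f x)) (@ger0_norm _ (t - x)) ?subr_ge0//.
by apply; [exact: le_trans ux | lra].
Qed.

Lemma is_derive_derivative_on_nneg (R : realType) (V : normedModType R)
    (f f' : R -> V) (t : R) :
  derivative_on_nneg f f' -> 0 < t -> is_derive t 1 f (f' t).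
Proof.
move=> df t0.
suff cf : (fun h => h^-1 *: (f (h *: 1 + t) - f t)) @ 0^' --> f' t.
  by apply: DeriveDef; [apply/cvg_ex; exists (f' t) | exact: cvg_lim cf].
apply/cvgrPdist_lt => e e0.
have /cvgrPdist_lt/(_ _ e0) := df t (ltW t0).
rewrite !near_withinE => /nbhs_ballP[d /= d0 dP].
(* A radius of at most [t] keeps [h + t] on the nonnegative axis, where the one-sided hypothesis
   applies. *)
apply/nbhs_ballP; exists (Num.min d t) => /=; first by rewrite lt_min d0.
move=> h; rewrite /ball/= sub0r normrN lt_min => /andP[hd ht] h0.
have := dP (h + t); rewrite /ball/= opprD addrCA subrr addr0 normrN addrK.
rewrite [h *: 1]mulr1; apply => //.
- by rewrite -subr_eq0 addrK.
- by have := ler_norm (- h); rewrite normrN; lra.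
Qed.

Lemma is_derive_entry (R : realType) (m p : nat) (t : R)
    (x : R -> 'M[R]_(m, p)) (dx : 'M[R]_(m, p)) i k :
  is_derive t 1 x dx -> is_derive t 1 (fun s => x s i k) (dx i k).
Proof.
move=> xdx; have dx' : derivable x t 1 by exact: ex_derive.
have <- : 'D_1 x t = dx by exact: derive_val.
rewrite derive_mx// mxE.
by apply: derivableP; exact: (derivable_mxP x t 1).1.
Qed.

(** * Fixed-time differential inequality *)

Lemma ae_lebesgue_imply (R : realType) (P Q : R -> Prop) :
  (forall t, P t -> Q t) -> {ae lebesgue_measure, forall t : R, P t} ->
  {ae lebesgue_measure, forall t : R, Q t}.
Proof. by move=> PQ; exact: (@filterS _ _ (ae_filter_ringOfSetsType _)). Qed.

(* [V `^ r / r] is an antiderivative of [V `^ (r - 1) * V'], so a positive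
   solution of [V' <= - g * V `^ (1 - r)] makes it decrease at rate [g]. *)
Lemma powR_decay (R : realType) (a b c g r : R) (V : R -> R) :
  a <= b -> 0 < c -> r != 0 -> abs_continuous a b V ->
  (forall t, a <= t -> t <= b -> c <= V t) ->
  {ae lebesgue_measure, forall t : R, a < t < b ->
     derivable V t 1 /\ 'D_1 V t <= - g * V t `^ (1 - r)} ->
  V b `^ r / r + g * (b - a) <= V a `^ r / r.
Proof.
move=> ab c0 r0 VAC cV aeV.
pose F t := V t `^ r * r^-1 + g * t.
suff : F b <= F a by rewrite /F; lra.
apply: (abs_continuous_nonincreasing ab).
  apply: abs_continuousD; last first.
    apply: (@abs_continuous_lipschitz _ _ _ _ `|g|) => u v _ uv _.
    by rewrite -mulrBr normrM (@ger0_norm _ (v - u)) ?subr_ge0.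
  apply: abs_continuousM; first exact: abs_continuous_powR c0 cV VAC.
  apply: (@abs_continuous_lipschitz _ _ _ _ 0) => u v _ _ _.
  by rewrite subrr normr0 mul0r.
apply: ae_lebesgue_imply aeV => t VD tab; have [dV DV] := VD tab.
have V0 : 0 < V t.
  by case/andP: tab => at_ tb; rewrite (lt_le_trans c0)// cV ?ltW.
have dF : is_derive t 1 F (r^-1 * (r * V t `^ (r - 1) * 'D_1 V t) + g * 1).
  have dVP := derivableP dV.
  have dpow := is_derive1_comp (is_derive1_powR r V0) dVP.
  have -> : F = (r^-1 \*: ((@powR R ^~ r) \o V)) + (g \*: id).
    by apply/funext => z; rewrite /F /= mulrC.
  exact: is_deriveD.
split; first exact: ex_derive.
rewrite derive_val mulrA mulrA mulVf// mul1r mulr1.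
apply: (@le_trans _ _ (V t `^ (r - 1) * (- g * V t `^ (1 - r)) + g)).
  by rewrite lerD2r ler_pM2l ?powR_gt0.
rewrite mulrCA -powRD; last by rewrite (gt_eqF V0) implybT.
by rewrite addrA subrK subrr powRr0 mulr1 addNr.
Qed.

Lemma fixed_time_convergence (R : realType) (al be m s : R) (V : R -> R) :
  0 < al -> 0 < be -> 1 < m -> s < 1 ->
  (forall t, 0 <= t -> 0 <= V t) ->
  (forall T, 0 < T -> abs_continuous 0 T V) ->
  {ae lebesgue_measure, forall t : R, 0 < t ->
     derivable V t 1 /\ 'D_1 V t <= - al * V t `^ m - be * V t `^ s} ->
  forall t, (al * (m - 1))^-1 + (be * (1 - s))^-1 <= t -> V t = 0.
Proof.
move=> al0 be0 m1 s1 V0 VAC aeV t.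
set T1 := (_ * (m - 1))^-1; set T2 := (_ * (1 - s))^-1 => Tt.
have T10 : 0 < T1 by rewrite invr_gt0 mulr_gt0// subr_gt0.
have T20 : 0 < T2 by rewrite invr_gt0 mulr_gt0// subr_gt0.
have t0 : 0 < t by lra.
(* If [V t] were positive, monotonicity would keep [V] above [V t] on [[0, t]], which is the
   positive lower bound that [powR_decay] asks for. *)
apply/eqP; rewrite eq_le (V0 _ (ltW t0)) andbT leNgt; apply/negP => Vt0.
have ACsub a b : 0 <= a -> b <= t -> abs_continuous a b V.
  move=> a0 bt e e0; have [d d0 Vd] := VAC t t0 e e0.
  exists d => // n u v uv; apply: Vd => i; have [? ? ?] := uv i.
  by split; [exact: le_trans a0 _ | | exact: le_trans bt].
have noninc x : 0 <= x -> x <= t -> V t <= V x.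
  move=> x0 xt; apply: (abs_continuous_nonincreasing xt); first exact: ACsub.
  apply: ae_lebesgue_imply aeV => z Vz /andP[xz zt]; have [|dV DV] := Vz.
    exact: le_lt_trans xz.
  split=> //; rewrite (le_trans DV)//.
  by rewrite mulNr -opprD oppr_le0 addr_ge0// mulr_ge0 ?powR_ge0// ltW.
(* Each phase keeps one of the two powers, [k], and applies [powR_decay] with [r = 1 - k]. *)
have phase a b g k : 0 <= a -> a <= b -> b <= t -> k != 1 ->
    (forall x, - al * V x `^ m - be * V x `^ s <= - g * V x `^ k) ->
    V b `^ (1 - k) / (1 - k) + g * (b - a) <= V a `^ (1 - k) / (1 - k).
  move=> a0 ab bt k1 gk; apply: powR_decay Vt0 _ _ _ _ => //.
  - by rewrite subr_eq0 eq_sym.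
  - exact: ACsub.
  - by move=> x ax xb; apply: noninc; [exact: le_trans ax | exact: le_trans bt].
  - apply: ae_lebesgue_imply aeV => z Vz /andP[az zb]; have [|dV DV] := Vz.
      exact: le_lt_trans az.
    by split=> //; rewrite subKr (le_trans DV).
have T1t : T1 <= t by lra.
have VT10 : 0 < V T1 by rewrite (lt_le_trans Vt0)// noninc// ltW.
have p1 r : 1 `^ r = 1 :> R by rewrite powR1.
(* The exponent [1 - m] is negative: if [V T1] exceeded 1, its power would be at most 1, while [T1]
   is just long enough to force that power above 1. *)
have VT1 : V T1 <= 1.
  rewrite leNgt; apply/negP => VT1.
  have := phase 0 T1 al m (lexx _) (ltW T10) T1t; rewrite gt_eqF// => /(_ isT).
  rewrite subr0 -[1 - m]opprB invrN !mulrN.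
  have -> : al * T1 = (m - 1)^-1 by rewrite /T1 invfM mulrA divff ?gt_eqF// mul1r.
  have x1 : V T1 `^ (- (m - 1)) <= 1.
    rewrite powRN invf_le1 ?powR_gt0// -[leLHS](p1 (m - 1)).
    by apply: ge0_ler_powR; rewrite ?nnegrE ?subr_ge0//; lra.
  have y0 : 0 < V 0 `^ (- (m - 1)).
    by rewrite powR_gt0// (lt_le_trans Vt0)// noninc// ltW.
  have m10 : 0 < (m - 1)^-1 by rewrite invr_gt0 subr_gt0.
  set x := V T1 `^ _ in x1 *; set y := V 0 `^ _ in y0 *; set k := _^-1 in m10 *.
  move=> H; have : - (x * k) + k <= - (y * k).
    by apply: H => z; rewrite lerBlDr lerDl mulr_ge0 ?powR_ge0 ?ltW.
  have := mulr_gt0 y0 m10; have : x * k <= 1 * k by rewrite ler_wpM2r// ltW.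
  by lra.
(* Starting from at most 1, the power [1 - s] of [V] loses at least 1 over the remaining time, which
   contradicts [V t] being positive. *)
have := phase T1 t be s (ltW T10) T1t (lexx _).
rewrite lt_eqF// => /(_ isT).
have be2 : (1 - s)^-1 <= be * (t - T1).
  apply: (@le_trans _ _ (be * T2)); last by rewrite ler_pM2l//; lra.
  by rewrite /T2 invfM mulrA divff ?gt_eqF// mul1r.
have x1 : V T1 `^ (1 - s) <= 1.
  rewrite -[leRHS](p1 (1 - s)).
  by apply: ge0_ler_powR; rewrite ?nnegrE ?subr_ge0//; lra.
have s10 : 0 < (1 - s)^-1 by rewrite invr_gt0 subr_gt0.
have y0 : 0 < V t `^ (1 - s) by rewrite powR_gt0.
set x := V T1 `^ _ in x1 *; set y := V t `^ _ in y0 *; set k := _^-1 in s10 be2 *.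
move=> H; have : y * k + be * (t - T1) <= x * k.
  apply: H => z; rewrite [leRHS]mulNr gerDr mulNr oppr_le0.
  by rewrite mulr_ge0 ?powR_ge0 ?ltW.
have := mulr_gt0 y0 s10; have : x * k <= 1 * k by rewrite ler_wpM2r// ltW.
by lra.
Qed.

(** * The Filippov regularization of the estimator *)

(** Degenerate boxes have volume zero because [i] and [k] provide a vanishing factor; with no
    entries, the empty product would give every box volume 1. *)
Lemma lebesgue_null_set0 (R : realType) m p (i : 'I_m) (k : 'I_p) :
  lebesgue_null (set0 : set 'M[R]_(m, p)).
Proof.
move=> e e0; exists (fun=> 0), (fun=> 0); split => //.
rewrite eseries0 ?lee_fin ?ltW// => l _ _.
by rewrite (bigD1 i)//= (bigD1 k)//= subrr !mul0r.
Qed.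

Lemma convex_entry_ball (R : realType) m p (i : 'I_m) (k : 'I_p) (c e : R) :
  convex_set [set v : 'M[R]_(m, p) | `|v i k - c| <= e].
Proof.
apply/convex_setW => x y; rewrite !inE /= => xe ye l l0 l1; rewrite inE /=.
rewrite !mxE.
rewrite -/(1 - l%:num).
have -> : l%:num * x i k + (1 - l%:num) * y i k - c =
  l%:num * (x i k - c) + (1 - l%:num) * (y i k - c) by ring.
have [l0' l1'] : 0 <= l%:num /\ 0 <= 1 - l%:num by rewrite subr_ge0 !ltW.
rewrite (le_trans (ler_normD _ _))// !normrM (ger0_norm l0') (ger0_norm l1').
have -> : e = l%:num * e + (1 - l%:num) * e by ring.
by apply: lerD; exact: ler_wpM2l.
Qed.

Lemma closed_entry_ball (R : realType) m p (i : 'I_m) (k : 'I_p) (c e : R) :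
  closed [set v : 'M[R]_(m, p) | `|v i k - c| <= e].
Proof.
apply: (@closed_comp _ _ (fun v : 'M[R]_(m, p) => v i k)
  [set z | `|z - c| <= e]); first by move=> v _; exact: coord_continuous.
apply: (@closed_comp _ _ (fun z => `|z - c|) [set z | z <= e]); last first.
  exact: closed_le.
by move=> z _; apply: cvg_norm; apply: cvgB; [exact: cvg_id | exact: cvg_cst].
Qed.

(** Near [x] the values of [g] lie in a strip that constrains only this entry. The strip is closed
    and convex, so it contains the hull, even if other entries of [g] jump at [x]. Testing with the
    empty null set suffices. *)
Lemma filippov_map_entry (R : realType) m p (g : 'M[R]_(m, p) -> 'M[R]_(m, p))
    (x w : 'M[R]_(m, p)) i k :
  {for x, continuous (fun y => g y i k)} -> filippov_map g x w ->
  w i k = g x i k.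
Proof.
move=> gc gw; apply/eqP; rewrite -subr_eq0 -normr_le0.
apply/ler_addgt0Pr => e e0; rewrite add0r.
have /cvgrPdist_lt/(_ _ e0)/nbhs_ballP[d /= d0 dP] := gc.
suff hullB : closed_convex_hull (g @` (ball x d `\` set0)) `<=`
    [set v | `|v i k - g x i k| <= e].
  exact: hullB (gw d d0 set0 (lebesgue_null_set0 i k)).
apply: smallest_sub.
  by split; [exact: closed_entry_ball | exact: convex_entry_ball].
by move=> _ [y [/dP/= xy _] <-]; rewrite /= distrC ltW.
Qed.

Lemma sg_continuous_neq0 (R : realType) (z : R) :
  z != 0 -> {for z, continuous (@Num.sg R)}.
Proof.
move=> z0; apply: cvg_near_cst; apply/nbhs_ballP; exists `|z| => /=.
  by rewrite normr_gt0.
move=> y; rewrite /ball/= ltr_distlC; have [zp|zn|z00] := ltrgt0P z.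
- by move=> /andP[? ?]; rewrite !gtr0_sg//; lra.
- by move=> /andP[? ?]; rewrite !ltr0_sg//; lra.
- by rewrite z00 eqxx in z0.
Qed.

Lemma sigpow_continuous_neq0 (R : realType) (p z : R) :
  z != 0 -> {for z, continuous (fun y => sigpow y p)}.
Proof.
move=> z0; apply: cvgM; last exact: sg_continuous_neq0.
apply: (@continuous_comp _ _ _ (fun y : R => `|y|) (@powR R ^~ p)).
  exact: norm_continuous.
apply/differentiable_continuous/derivable1_diffP/derivable_powR.
by rewrite in_itv/= andbT normr_gt0.
Qed.

(** The row sums on the diagonal of the Laplacian collect the agent's own error, and the leader's
    error is zero, so [b] enters only on the diagonal. *)
Lemma estimation_errorE (R : realType) n (A : 'M[R]_n) (b : 'rV[R]_n)
    (xo : 'rV[R]_3) (x : 'M[R]_(n, 3)) i k :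
  estimation_error A b xo x i k =
  \sum_j (laplacian A + diag_mx b) i j * (x j k - xo 0 k).
Proof.
rewrite /estimation_error mxE subr0 !mxE summxE.
transitivity (b 0 i * (x i k - xo 0 k) +
    \sum_j (A i j * (x i k - xo 0 k) - A i j * (x j k - xo 0 k))).
  congr (_ + _); apply: eq_bigr => j _; rewrite !mxE -mulrBr; congr (_ * _).
rewrite sumrB -mulr_suml.
under [RHS]eq_bigr do rewrite !mxE mulrDl mulrBl.
rewrite big_split sumrB/= [RHS]addrC; congr (_ + _).
  rewrite (bigD1 i)//= eqxx mulr1n big1 ?addr0// => j ji.
  by rewrite eq_sym (negbTE ji) mul0r.
congr (_ - _); rewrite [RHS](bigD1 i)//= eqxx mulr1n.
rewrite [X in _ = _ + X]big1 ?addr0// => j ji.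
by rewrite eq_sym (negbTE ji) mul0r.
Qed.

Lemma continuous_affine_sum (R : realType) (T : topologicalType) n
    (c d : 'I_n -> R) (f : 'I_n -> T -> R) :
  (forall j, continuous (f j)) ->
  continuous (fun x => \sum_j c j * (f j x - d j)).
Proof.
move=> fc x; apply: cvg_big => [|j _]; first exact: add_continuous.
apply: cvgM; first exact: cvg_cst.
by apply: cvgB; [exact: fc | exact: cvg_cst].
Qed.

Lemma estimation_error_continuous (R : realType) n (A : 'M[R]_n) (b : 'rV[R]_n)
    (xo : 'rV[R]_3) i k :
  continuous (fun x : 'M[R]_(n, 3) => estimation_error A b xo x i k).
Proof.
rewrite (_ : (fun x => _) = fun x : 'M[R]_(n, 3) =>
    \sum_j (laplacian A + diag_mx b) i j * (x j k - xo 0 k)).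
  by apply: continuous_affine_sum => j; exact: coord_continuous.
by apply/funext => x; rewrite estimation_errorE.
Qed.

Lemma filippov_estimator_entry (R : realType) n (A : 'M[R]_n) (b : 'rV[R]_n)
    (K1 K2 K3 p q : R) (xo : R -> 'rV[R]_3) t (x w : 'M[R]_(n, 3)) i k :
  filippov_map (estimator A b K1 K2 K3 p q xo t) x w ->
  let e := estimation_error A b (xo t) x i k in
  e != 0 -> w i k = - K1 * sigpow e p - K2 * sigpow e q - K3 * Num.sg e.
Proof.
move=> xw e e0.
(* This entry of the field depends on the state only through one scalar error, so its continuity
   where that error is nonzero is a scalar matter. *)
pose h z := - K1 * sigpow z p - K2 * sigpow z q - K3 * Num.sg z.
have fE : (fun y => estimator A b K1 K2 K3 p q xo t y i k) =
    h \o (fun y => estimation_error A b (xo t) y i k).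
  by apply/funext => y; rewrite /estimator mxE.
suff fc : {for x, continuous (fun y => estimator A b K1 K2 K3 p q xo t y i k)}.
  by rewrite (filippov_map_entry fc xw) /estimator mxE.
rewrite fE; apply: continuous_comp; first exact: estimation_error_continuous.
have cst_mul (c : R) (f : R -> R) : {for e, continuous f} ->
    {for e, continuous (fun z => c * f z)}.
  by move=> fe; apply: cvgM => //; exact: cvg_cst.
apply: cvgB; last exact/cst_mul/sg_continuous_neq0.
by apply: cvgB; apply: cst_mul; exact: sigpow_continuous_neq0.
Qed.

(** * The quadratic Lyapunov function *)

Lemma posdefmx_unitmx (R : realType) n (H : 'M[R]_n) :
  posdefmx H -> H \in unitmx.
Proof.
move=> [_ Hpos]; rewrite -row_free_unit -kermx_eq0; apply/rowV0P => v.
move=> /sub_kermxP vH; apply/eqP/negPn/negP => v0.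
have : v^T != 0 by rewrite -(inj_eq (can_inj (@trmxK _ _ _))) trmxK trmx0.
by move/Hpos; rewrite trmxK vH mul0mx mxE ltxx.
Qed.

(** The trace of [Y^T H Y]; in its use, column [k] of [Y] holds the agents' errors along coordinate
    [k]. *)
Definition quadform (R : realType) m p (H : 'M[R]_m) (Y : 'M[R]_(m, p)) : R :=
  \sum_k \sum_i \sum_j H i j * (Y i k * Y j k).

Lemma quadformE (R : realType) m p (H : 'M[R]_m) (Y : 'M[R]_(m, p)) :
  quadform H Y = \sum_k ((col k Y)^T *m H *m col k Y) 0 0.
Proof.
apply: eq_bigr => k _; rewrite -mulmxA mxE; apply: eq_bigr => i _.
rewrite !mxE mulr_sumr; apply: eq_bigr => j _; rewrite !mxE; ring.
Qed.

Lemma quadform_mulmx (R : realType) m p (H : 'M[R]_m) (Y : 'M[R]_(m, p)) :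
  quadform H Y = \sum_k \sum_i Y i k * (H *m Y) i k.
Proof.
apply: eq_bigr => k _; apply: eq_bigr => i _.
by rewrite mxE mulr_sumr; apply: eq_bigr => j _; ring.
Qed.

Lemma posdefmx_ge0 (R : realType) m (H : 'M[R]_m) (v : 'cV[R]_m) :
  posdefmx H -> 0 <= (v^T *m H *m v) 0 0.
Proof.
move=> [_ posH]; have [->|v0] := eqVneq v 0; first by rewrite mulmx0 mxE.
by rewrite ltW// posH.
Qed.

Lemma quadform_ge0 (R : realType) m p (H : 'M[R]_m) (Y : 'M[R]_(m, p)) :
  posdefmx H -> 0 <= quadform H Y.
Proof.
by move=> posH; rewrite quadformE sumr_ge0// => k _; exact: posdefmx_ge0.
Qed.

Lemma quadform_eq0 (R : realType) m p (H : 'M[R]_m) (Y : 'M[R]_(m, p)) :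
  posdefmx H -> quadform H Y = 0 -> Y = 0.
Proof.
move=> posH; rewrite quadformE => /eqP.
rewrite psumr_eq0 => [/allP Y0|k _]; last exact: posdefmx_ge0.
apply/matrixP => i k; rewrite mxE.
have [/matrixP/(_ i 0)|/posH.2] := eqVneq (col k Y) 0; first by rewrite !mxE.
by move/gt_eqF; rewrite (eqP (Y0 k _)) ?mem_index_enum// eqxx.
Qed.

(** Inverting [H] bounds each entry of [Y] by a constant times the norm of [H *m Y], and the form is
    a sum of products of entries of these two matrices. *)
Lemma quadform_le_norm (R : realType) m p (H : 'M[R]_m) :
  posdefmx H -> exists2 C : R, 0 < C & forall Y : 'M[R]_(m, p),
    quadform H Y <= C * `|H *m Y| ^+ 2.
Proof.
move=> posH; pose c := \sum_i \sum_j `|invmx H i j|.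
have c_ge0 : 0 <= c by apply: sumr_ge0 => i _; apply: sumr_ge0.
(* The added 1 keeps [C] positive even when the sums are empty. *)
exists (1 + \sum_(k < p) \sum_(i < m) c) => [|Y].
  by rewrite ltr_pwDl// sumr_ge0// => k _; exact: sumr_ge0.
set E := H *m Y.
have YE i k : `|Y i k| <= c * `|E|.
  have -> : Y = invmx H *m E by rewrite mulKmx// posdefmx_unitmx.
  rewrite mxE (le_trans (ler_norm_sum _ _ _))//.
  apply: (@le_trans _ _ (\sum_j `|invmx H i j| * `|E|)).
    by apply: ler_sum => j _; rewrite normrM ler_wpM2l// ler_mx_entry_norm.
  rewrite -mulr_suml ler_wpM2r// /c [leRHS](bigD1 i)//= lerDl.
  by apply: sumr_ge0 => j _; exact: sumr_ge0.
rewrite mulrDl mul1r quadform_mulmx.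
apply: le_trans (_ : (\sum_(k < p) \sum_(i < m) c) * `|E| ^+ 2 <= _); last first.
  by rewrite lerDr sqr_ge0.
rewrite mulr_suml; apply: ler_sum => k _; rewrite mulr_suml; apply: ler_sum => i _.
rewrite (le_trans (ler_norm _))// normrM expr2 mulrA.
by rewrite ler_pM// ler_mx_entry_norm.
Qed.

Lemma is_derive_sum_fun (R : realType) n (h : 'I_n -> R -> R) (x : R)
    (dh : 'I_n -> R) :
  (forall i, is_derive x 1 (h i) (dh i)) ->
  is_derive x 1 (fun t => \sum_i h i t) (\sum_i dh i).
Proof.
move=> hd; rewrite (_ : (fun t => _) = \sum_i h i); first exact: is_derive_sum.
by apply/funext => t; rewrite fct_sumE.
Qed.

(** By symmetry of [H] the two halves of the product rule have the same sum, whence the factor 2. *)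
Lemma is_derive_quadform (R : realType) m p (H : 'M[R]_m)
    (Y : R -> 'M[R]_(m, p)) (t : R) (dY : 'M[R]_(m, p)) :
  H^T = H -> (forall i k, is_derive t 1 (fun s => Y s i k) (dY i k)) ->
  is_derive t 1 (fun s => quadform H (Y s))
    (2 * \sum_k \sum_i (H *m Y t) i k * dY i k).
Proof.
move=> symH dYP.
have -> : 2 * \sum_k \sum_i (H *m Y t) i k * dY i k =
    \sum_k \sum_i \sum_j H i j * (Y t i k * dY j k + Y t j k * dY i k).
  rewrite mulr_sumr; apply: eq_bigr => k _.
  have row_sum i : (H *m Y t) i k * dY i k = \sum_j H i j * (Y t j k * dY i k).
    by rewrite mxE mulr_suml; apply: eq_bigr => j _; rewrite mulrA.
  have Hsym i j : H i j = H j i by rewrite -{1}symH mxE.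
  rewrite mulr2n mulrDl mul1r; under eq_bigr do rewrite row_sum.
  rewrite {1}exchange_big -big_split; apply: eq_bigr => i _ /=.
  rewrite -big_split; apply: eq_bigr => j _ /=.
  by rewrite (Hsym j i) mulrDr.
apply: is_derive_sum_fun => k; apply: is_derive_sum_fun => i.
apply: is_derive_sum_fun => j.
have dM := is_deriveZ (H i j) (is_deriveM (dYP i k) (dYP j k)).
rewrite (_ : (fun s => _) =
  H i j \*: ((fun s => Y s i k) * (fun s => Y s j k))); first exact: dM.
by apply/funext.
Qed.

(** * Dissipation along the estimator *)

Lemma mul_sigpow (R : realType) (e p : R) :
  e != 0 -> e * sigpow e p = `|e| `^ (p + 1).
Proof.
move=> e0; rewrite /sigpow mulrCA [e * _]mulrC -normrEsg powRD ?powRr1//.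
by rewrite normr_eq0 e0 implybT.
Qed.

(* [w] is unconstrained when [e = 0]: there the set-valued sign of the
   Filippov regularization is multiplied by zero. *)
Lemma dissipation (R : realType) (K1 K2 K3 p q e w v : R) :
  0 < p -> 0 < q -> `|v| <= K3 ->
  (e != 0 -> w = - K1 * sigpow e p - K2 * sigpow e q - K3 * Num.sg e) ->
  e * (w - v) <= - (K1 * `|e| `^ (p + 1) + K2 * `|e| `^ (q + 1)).
Proof.
move=> p0 q0 vK we; have [->|e0] := eqVneq e 0.
  rewrite mul0r normr0 !powR0 ?mulr0 ?addr0 ?oppr0//; apply: lt0r_neq0; lra.
have -> : e * (w - v) =
    - (K1 * (e * sigpow e p) + K2 * (e * sigpow e q)) -
    (K3 * (e * Num.sg e) + e * v) by rewrite (we e0); ring.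
rewrite !mul_sigpow// [e * Num.sg e]mulrC -normrEsg gerBl.
have : - (e * v) <= K3 * `|e|.
  by rewrite (le_trans (ler_norm _))// normrN normrM mulrC ler_wpM2r.
by lra.
Qed.

(** The norm is the largest absolute entry, so its power already occurs among the summands. Norm
    zero is treated apart, since the matrix may then have no entry. *)
Lemma powR_norm_le_sum (R : realType) m p (E : 'M[R]_(m, p)) (r : R) :
  r != 0 -> `|E| `^ r <= \sum_k \sum_i `|E i k| `^ r.
Proof.
move=> r0.
have ge0 k : 0 <= \sum_i `|E i k| `^ r by apply: sumr_ge0 => i _; exact: powR_ge0.
have [E0|/(@mx_norm_neq0 _ _ _ E)[[i k] /= Eik]] := eqVneq `|E| 0.
  by rewrite E0 powR0// sumr_ge0.
rewrite [`|E|]Eik (bigD1 k)//= (bigD1 i)//= -addrA lerDl addr_ge0//.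
  by apply: sumr_ge0 => j _; exact: powR_ge0.
by apply: sumr_ge0 => j _; exact: ge0.
Qed.

(** This trades dissipation, a power of the error norm [N], for a power of [W]; the exponent is
    halved because [W] is compared with the square of [N]. *)
Lemma powR_le_sqr (R : realType) (W C N r : R) :
  0 <= W -> 0 < C -> 0 <= N -> 0 < r -> W <= C * N ^+ 2 ->
  W `^ (r / 2) / C `^ (r / 2) <= N `^ r.
Proof.
move=> W0 C0 N0 r0 WC; rewrite ler_pdivrMr ?powR_gt0//.
have -> : N `^ r = (N ^+ 2) `^ (r / 2).
  by rewrite -powR_mulrn// -powRrM mulrCA divff ?mulr1// pnatr_eq0.
rewrite [leRHS]mulrC -(powRM _ (ltW C0) (sqr_ge0 N)).
apply: ge0_ler_powR => //; rewrite ?nnegrE//; first by rewrite ltW// divr_gt0.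
exact: le_trans WC.
Qed.

(** The dissipation is summed over all entries, bounded below through the largest one, and compared
    with the quadratic form through [C]; this produces the coefficients. *)
Lemma quadform_estimator_decay (R : realType) (n : nat) (A : 'M[R]_n)
    (b : 'rV[R]_n) (K1 K2 K3 p q C : R) (xo : R -> 'rV[R]_3) (vo : 'rV[R]_3)
    (t : R) (x w : 'M[R]_(n, 3)) :
  let H := laplacian A + diag_mx b in
  let Y := \matrix_(i, k) (x i k - xo t 0 k) in
  let dY := \matrix_(i, k) (w i k - vo 0 k) in
  posdefmx H -> 0 < C -> quadform H Y <= C * `|H *m Y| ^+ 2 ->
  0 < K1 -> 0 < K2 -> 0 < p -> 0 < q -> `|vo| <= K3 ->
  filippov_map (estimator A b K1 K2 K3 p q xo t) x w ->
  2 * \sum_k \sum_i (H *m Y) i k * dY i k <=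
    - (2 * K1 / C `^ ((p + 1) / 2)) * quadform H Y `^ ((p + 1) / 2)
    - 2 * K2 / C `^ ((q + 1) / 2) * quadform H Y `^ ((q + 1) / 2).
Proof.
move=> H Y dY posH C0 WC K10 K20 p0 q0 voK xw; set E := H *m Y.
have eE i k : estimation_error A b (xo t) x i k = E i k.
  rewrite estimation_errorE [RHS]mxE; apply: eq_bigr => j _.
  by rewrite [Y _ _]mxE.
have term i k : E i k * dY i k <=
    - (K1 * `|E i k| `^ (p + 1) + K2 * `|E i k| `^ (q + 1)).
  rewrite [dY _ _]mxE; apply: (@dissipation _ _ _ K3) => //.
    exact: le_trans (ler_mx_entry_norm _ _ _) voK.
  by rewrite -eE; exact: filippov_estimator_entry xw.
have p1 : 0 < p + 1 by lra.
have q1 : 0 < q + 1 by lra.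
have W0 := quadform_ge0 Y posH.
have sump := powR_norm_le_sum E (lt0r_neq0 p1).
have sumq := powR_norm_le_sum E (lt0r_neq0 q1).
have Wp := powR_le_sqr W0 C0 (normr_ge0 E) p1 WC.
have Wq := powR_le_sqr W0 C0 (normr_ge0 E) q1 WC.
have : \sum_k \sum_i E i k * dY i k <=
    - (K1 * \sum_k \sum_i `|E i k| `^ (p + 1) +
       K2 * \sum_k \sum_i `|E i k| `^ (q + 1)).
  rewrite !mulr_sumr -big_split -sumrN; apply: ler_sum => k _ /=.
  rewrite !mulr_sumr -big_split -sumrN; apply: ler_sum => i _ /=.
  exact: term.
have := ler_wpM2l (ltW K10) (le_trans Wp sump).
have := ler_wpM2l (ltW K20) (le_trans Wq sumq).
have -> : - (2 * K1 / C `^ ((p + 1) / 2)) * quadform H Y `^ ((p + 1) / 2) =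
  - (2 * (K1 * (quadform H Y `^ ((p + 1) / 2) / C `^ ((p + 1) / 2)))) by ring.
have -> : 2 * K2 / C `^ ((q + 1) / 2) * quadform H Y `^ ((q + 1) / 2) =
  2 * (K2 * (quadform H Y `^ ((q + 1) / 2) / C `^ ((q + 1) / 2))) by ring.
by lra.
Qed.

Lemma abs_continuous_quadform (R : realType) m p (a b : R) (H : 'M[R]_m)
    (Y : R -> 'M[R]_(m, p)) :
  (forall i k, abs_continuous a b (fun t => Y t i k)) ->
  abs_continuous a b (fun t => quadform H (Y t)).
Proof.
move=> YAC; apply: abs_continuous_sum => k; apply: abs_continuous_sum => i.
apply: abs_continuous_sum => j; apply: abs_continuousM.
  by apply: (@abs_continuous_lipschitz _ _ _ _ 0) => *; rewrite subrr normr0 mul0r.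
exact: abs_continuousM.
Qed.

(** * Fixed-time convergence of the estimates *)

Theorem lemma3 (R : realType) (n : nat) (A : 'M[R]_n) (b : 'rV[R]_n)
    (K1 K2 K3 r3 r4 r5 r6 : R) (vo ao : R -> 'rV[R]_3) :
  (2 <= n)%N ->
  A^T = A ->
  (forall i j, 0 <= A i j) ->
  (forall i, 0 <= b 0 i) ->
  (exists i, b 0 i = 1) ->
  0 < K1 -> 0 < K2 -> 0 < K3 ->
  0 < r3 -> 0 < r4 -> 0 < r5 -> 0 < r6 ->
  1 < r3 / r4 -> r5 / r6 < 1 ->
  posdefmx (laplacian A + diag_mx b) ->
  derivative_on_nneg vo ao ->
  (ereal_sup [set (`|vo t|)%:E | t in [set t : R | (0 <= t)%R]] <= K3%:E)%E ->
  exists2 Te : R, 0 < Te &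
    forall (xo : R -> 'rV[R]_3) (xhat : R -> 'M[R]_(n, 3)),
      derivative_on_nneg xo vo ->
      filippov_solution (estimator A b K1 K2 K3 (r3 / r4) (r5 / r6) xo) xhat ->
      forall t, Te <= t -> forall i, row i (xhat t) = xo t.
Proof.
move=> _ _ _ _ _ K10 K20 K30 r30 r40 r50 r60.
have := divr_gt0 r50 r60; move: (r3 / r4) (r5 / r6) => p q q0 p1 q1 posH _ supK.
set H := laplacian A + diag_mx b in posH.
have p0 : 0 < p by lra.
have voK t : 0 <= t -> `|vo t| <= K3.
  move=> t0; rewrite -lee_fin (le_trans _ supK)//.
  by apply: ereal_sup_ubound; exists t.
have [C C0 WC] := quadform_le_norm 3 posH.
pose m := (p + 1) / 2; pose s := (q + 1) / 2.
pose al := 2 * K1 / C `^ m; pose be := 2 * K2 / C `^ s.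
have al0 : 0 < al by rewrite divr_gt0 ?powR_gt0// mulr_gt0.
have be0 : 0 < be by rewrite divr_gt0 ?powR_gt0// mulr_gt0.
have m1 : 1 < m by rewrite /m; lra.
have s1 : s < 1 by rewrite /s; lra.
(* The settling time is chosen before [xo] and [xhat]: it adds the two phase lengths, which depend
   only on the gains, the exponents and [C], and [C] depends only on [H]. *)
exists ((al * (m - 1))^-1 + (be * (1 - s))^-1) => [|xo x xoD [xAC xF] t Tt i].
  by rewrite addr_gt0// invr_gt0 mulr_gt0// subr_gt0.
pose Y t := \matrix_(i, k) (x t i k - xo t 0 k).
suff W0 : quadform H (Y t) = 0.
  apply/rowP => k; rewrite mxE; apply/eqP; rewrite -subr_eq0.
  by have /matrixP/(_ i k) := quadform_eq0 posH W0; rewrite !mxE => ->.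
apply: (fixed_time_convergence (V := fun u => quadform H (Y u)) al0 be0 m1 s1 _ _ _ Tt) => [u _|T T0|].
- exact: quadform_ge0.
- apply: abs_continuous_quadform => j k.
  (* Bounded velocity makes the leader Lipschitz, so the errors are absolutely continuous like the
     Filippov solution. *)
  have xoAC : abs_continuous 0 T xo.
    apply: (@abs_continuous_lipschitz _ _ _ _ K3) => u v u0 uv _.
    exact: (derivative_on_nneg_lipschitz xoD).
  rewrite (_ : (fun t => _) = fun t => x t j k - xo t 0 k).
    by apply: abs_continuousB; apply: abs_continuous_entry => //; exact: xAC.
  by apply/funext => u; rewrite mxE.
(* The leader is differentiable at every positive time, so the only exceptional times are those of
   the Filippov solution. *)
apply: ae_lebesgue_imply xF => u xFu u0; have [dx xw] := xFu u0.
pose dY := \matrix_(j, k) ('D_1 x u j k - vo u 0 k).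
have dYP j k : is_derive u 1 (fun v => Y v j k) (dY j k).
  rewrite [dY j k]mxE.
  rewrite (_ : (fun v => _) = (fun v => x v j k) - (fun v => xo v 0 k)).
    apply: is_deriveB; first exact/is_derive_entry/derivableP.
    exact/is_derive_entry/is_derive_derivative_on_nneg.
  by apply/funext => v; rewrite mxE.
have dW := is_derive_quadform posH.1 dYP.
split; first exact: ex_derive.
rewrite derive_val.
by apply: (@quadform_estimator_decay _ _ A b _ _ K3 _ _ _ xo) => //;
  exact/voK/ltW.
Qed.
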